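(* For every positive integer $r$ there is a constant $c_r>0$, depending only on $r$, such that the following holds. Let $p$ be a prime and let $c:\mathbb{F}_p\to\{1,\dots,r\}$ be any $r$-colouring of $\mathbb{F}_p=\mathbb{Z}/p\mathbb{Z}$. Then there are at least $c_r p^2$ triples $(x,y,z)\in\mathbb{F}_p^3$ with $x+y=z^2$ and $c(x)=c(y)=c(z)$.
   Context: $p$ denotes a prime and $\mathbb{F}_p=\mathbb{Z}/p\mathbb{Z}$. The constant $c_r$ does not depend on $p$. *)

(* Defs.v *)
From HB Require Import structures.
From mathcomp Require Import all_boot all_order all_algebra.
From mathcomp Require Import reals.

Set Implicit Arguments.
Unset Strict Implicit.
Unset Printing Implicit Defensive.

Import Order.TTheory GRing.Theory Num.Theory.
Local Open Scope ring_scope.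

Definition mono_triples (p r : nat) (c : 'F_p -> 'I_r) :
    {set 'F_p * 'F_p * 'F_p} :=
  [set t | let: (x, y, z) := t in
           [&& x + y == z ^+ 2, c x == c y & c y == c z]].

(* Main.v *)
(** Let f_i be the indicator of the i-th colour class and g_i its pushforward
    under squaring, so that the number of monochromatic triples is
    Lambda = sum_i sum_(x,y) f_i(x) f_i(y) g_i(x+y).
    Random sampling and pigeonhole give a dense set T of common L^2 almost-periods
    of the correlations x |-> sum_y f_i(y) g_i(x+y), and Lambda hardly changes when
    every f_i and g_i is averaged over translates by T.
    As z |-> (z+h)^2 - z^2 is a bijection for h <> 0, the pairs (z, z^2) are
    equidistributed at the scale of T: for almost all (u,v) the expected number of
    z has z in u+T and z^2 in v+T.  Hence for almost all (u,v) some colour is dense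
    near u (for f) and near v (for g).  Taking u1, u2 with the same set of dense
    colours and v = u1 + u2 then gives a colour dense near u1, near u2 and,
    among the squares, near u1 + u2.
    Only the bijectivity of the differences of z^2 is used, so the argument works for
    planar functions on finite abelian groups. *)

Require Import Defs.
From HB Require Import structures.
From mathcomp Require Import all_boot all_order all_algebra.
From mathcomp Require Import reals.
From mathcomp Require Import ring lra.

Set Implicit Arguments.
Unset Strict Implicit.
Unset Printing Implicit Defensive.

Import Order.TTheory GRing.Theory Num.Theory.
Local Open Scope ring_scope.

(** * Averaging and random sampling *)

Section Averaging.
Variable R : realFieldType.

Lemma exists_le_average (Y : finType) (a : Y -> R) (B : R) :
  (0 < #|Y|)%N -> \sum_y a y <= #|Y|%:R * B -> exists y, a y <= B.
Proof.
move=> Y0 le; apply/existsP; apply: contraLR le; rewrite negb_exists -ltNge.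
move=> /forallP H; rewrite mulr_natl -sumr_const.
case/card_gt0P: Y0 => y0 _.
apply: ltr_sum => [|y _]; last by rewrite ltNge H.
by apply/hasP; exists y0; rewrite ?mem_index_enum.
Qed.

Lemma exists_ge_average (Y : finType) (a : Y -> R) (B : R) :
  (0 < #|Y|)%N -> #|Y|%:R * B <= \sum_y a y -> exists y, B <= a y.
Proof.
move=> Y0 le; have [|y] := @exists_le_average Y (fun y => - a y) (- B) Y0.
  by rewrite sumrN mulrN lerN2.
by rewrite lerN2; exists y.
Qed.

Lemma pigeonhole_card (A B : finType) (P : {set A}) (h : A -> B) :
  (0 < #|B|)%N ->
  exists b, #|P|%:R <= #|B|%:R * #|[set a in P | h a == b]|%:R :> R.
Proof.
move=> B0; have B0' : 0 < #|B|%:R :> R by rewrite ltr0n.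
have [|b Hb] := @exists_ge_average B (fun b => #|[set a in P | h a == b]|%:R)
  (#|P|%:R / #|B|%:R) B0; last first.
  by exists b; rewrite mulrC -ler_pdivrMr.
rewrite mulrCA divff ?gt_eqF// mulr1 -natr_sum ler_nat.
rewrite -sum1_card (partition_big h predT) //=.
by apply: leq_sum => b _; rewrite -sum1dep_card; apply: eq_leq; apply: eq_bigl => a; rewrite ?inE.
Qed.

(* The cross terms average to zero over the next sample, so some choice of it
   adds at most [V] to the sum of squares. *)
Lemma greedy_sampling (J Y : finType) (X : Y -> J -> R) (V : R) (k : nat) :
  (0 < #|Y|)%N -> (forall j, \sum_y X y j = 0) ->
  \sum_j \sum_y X y j ^+ 2 <= #|Y|%:R * V ->
  exists ys : k.-tuple Y, \sum_j (\sum_(y <- ys) X y j) ^+ 2 <= k%:R * V.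
Proof.
move=> Y0 X0 XV; elim: k => [|k [ys IH]].
  exists [tuple]; rewrite mul0r big1 // => j _.
  by rewrite big_nil expr0n.
have [|y Hy] := @exists_le_average Y
  (fun y => \sum_j (X y j + \sum_(y <- ys) X y j) ^+ 2) (k.+1%:R * V) Y0.
  rewrite exchange_big /=.
  under eq_bigr => j _.
    under eq_bigr => y _ do rewrite sqrrD.
    rewrite !big_split /= -mulr_suml X0 mul0r !addr0 sumr_const.
    over.
  rewrite big_split /= sumrMnl -(mulr_natl (\sum_j _)).
  rewrite -natr1 mulrDl mul1r mulrDr addrC; apply: lerD => //.
  by rewrite ler_wpM2l.
by exists [tuple of y :: ys]; under eq_bigr do rewrite big_cons.
Qed.

End Averaging.

(** * Common almost-periods of the correlations *)

Section AlmostPeriods.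
Variables (R : realFieldType) (G : finZmodType).
Let n : R := #|G|%:R.

Lemma card_zmod_gt0 : (0 < #|G|)%N.
Proof. by apply/card_gt0P; exists 0. Qed.

Lemma cardR_gt0 : 0 < n. Proof. by rewrite ltr0n card_zmod_gt0. Qed.

Lemma sum_translate (F : G -> R) (a : G) : \sum_x F (x + a) = \sum_x F x.
Proof. by rewrite [RHS](reindex_inj (addIr a)). Qed.

Lemma sum_translateN (F : G -> R) (a : G) : \sum_x F (a - x) = \sum_x F x.
Proof. by rewrite [RHS](reindex_inj (subrI a)). Qed.

Definition corr (f g : G -> R) (x : G) : R := \sum_y f y * g (x + y).

Definition ind (r : nat) (c : G -> 'I_r) (i : 'I_r) (x : G) : R :=
  (c x == i)%:R.

Lemma ind_ge0 r (c : G -> 'I_r) i x : 0 <= ind c i x.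
Proof. exact: ler0n. Qed.

Lemma ind_sqr r (c : G -> 'I_r) i x : ind c i x ^+ 2 = ind c i x.
Proof. by rewrite /ind; case: eqP; rewrite ?expr1n ?expr0n. Qed.

Lemma sum_ind r (c : G -> 'I_r) x : \sum_i ind c i x = 1.
Proof.
rewrite /ind (bigD1 (c x)) //= eqxx big1 ?addr0 // => i.
by rewrite eq_sym => /negbTE ->.
Qed.

(** Croot-Sisask sampling: the translate by [a] of a correlation is an average over [y] that sees
    [a] only through the colour [c (y - a)]. Shifts with small sampling error and the same colours
    at the [k] sample points thus have nearly equal translates, for all [i] at once, and there are
    only [r ^ k] colour patterns. *)
Lemma almost_periods r (c : G -> 'I_r) (g : 'I_r -> G -> R) (V : R) (k : nat) :
  (0 < r)%N -> (0 < k)%N -> 0 < V -> (forall i, \sum_x g i x ^+ 2 <= V * n) ->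
  exists T : {set G}, n <= 2 * r%:R ^+ k * #|T|%:R /\
    forall t i, t \in T ->
      k%:R * (\sum_x (corr (ind c i) (g i) (x + t) - corr (ind c i) (g i) x) ^+ 2)
        <= 8 * V * n ^+ 3.
Proof.
move=> r0 k0 V0 gV.
have n0 := cardR_gt0.
have kR : 0 < k%:R :> R by rewrite ltr0n.
pose h i := corr (ind c i) (g i).
have hE i a x : h i (x + a) = \sum_y ind c i (y - a) * g i (x + y).
  rewrite /h /corr -[RHS](sum_translate _ a).
  by apply: eq_bigr => y _; rewrite addrK addrAC -!addrA.
(* Error of a one-point sample, scaled by [n]. The index [j = (a, (i, x))] runs over shift, colour
   and point, so that one tuple of samples serves all of them. *)
pose X (y : G) (j : G * ('I_r * G)) : R :=
  n * (ind c j.2.1 (y - j.1) * g j.2.1 (j.2.2 + y)) - h j.2.1 (j.2.2 + j.1).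
have X0 j : \sum_y X y j = 0.
  by rewrite sumrB -mulr_sumr -hE sumr_const -mulr_natl subrr.
have XV : \sum_j \sum_y X y j ^+ 2 <= #|G|%:R * (V * n ^+ 4).
  rewrite -/n.
  (* The variance is at most the second moment. Keeping the weight [ind] lets the later sum over
     colours collapse to 1, with no factor [r]. *)
  have le1 j : \sum_y X y j ^+ 2 <=
      n ^+ 2 * (\sum_y ind c j.2.1 (y - j.1) * g j.2.1 (j.2.2 + y) ^+ 2).
    have -> : \sum_y X y j ^+ 2 =
        n ^+ 2 * (\sum_y ind c j.2.1 (y - j.1) * g j.2.1 (j.2.2 + y) ^+ 2)
        - n * h j.2.1 (j.2.2 + j.1) ^+ 2.
      pose b y := ind c j.2.1 (y - j.1) * g j.2.1 (j.2.2 + y).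
      set H := h _ _; have HE : \sum_y b y = H by rewrite /H hE.
      transitivity (\sum_y (n ^+ 2 * (ind c j.2.1 (y - j.1) * g j.2.1 (j.2.2 + y) ^+ 2)
          + (- (2 * n * H) * b y + H ^+ 2))).
        by apply: eq_bigr => y _; rewrite -[in RHS]ind_sqr -exprMn /X -/H /b; ring.
      rewrite big_split /= -mulr_sumr big_split /= -mulr_sumr HE sumr_const.
      by rewrite -[_ *+ #|_|]mulr_natl -/n; ring.
    by rewrite lerBlDr lerDl mulr_ge0 ?sqr_ge0 // ltW.
  apply: le_trans (ler_sum _ (fun j _ => le1 j)) _.
  rewrite -mulr_sumr.
  rewrite -(pair_bigA _ (fun a j => \sum_y ind c j.1 (y - a) * g j.1 (j.2 + y) ^+ 2)) /=.
  have -> : n * (V * n ^+ 4) = n ^+ 2 * \sum_(a : G) (n * (V * n)).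
    by rewrite sumr_const -mulr_natl -/n; ring.
  rewrite ler_wpM2l ?sqr_ge0 //; apply: ler_sum => a _.
  rewrite -(pair_bigA _ (fun i x => \sum_y ind c i (y - a) * g i (x + y) ^+ 2)) /=.
  under eq_bigr => i _.
    rewrite exchange_big /=.
    under eq_bigr => y _ do rewrite -mulr_sumr (sum_translate (fun x => g i x ^+ 2)).
    over.
  rewrite exchange_big /=.
  have -> : n * (V * n) = \sum_(y : G) V * n.
    by rewrite sumr_const -mulr_natl.
  apply: ler_sum => y _.
  apply: (@le_trans _ _ (\sum_i ind c i (y - a) * (V * n))).
    by apply: ler_sum => i _; rewrite ler_wpM2l ?ind_ge0.
  by rewrite -mulr_suml sum_ind mul1r.
have [ys] := greedy_sampling k card_zmod_gt0 X0 XV.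
pose E a := \sum_(j : 'I_r * G) (\sum_(y <- ys) X y (a, j)) ^+ 2.
rewrite -(pair_bigA _ (fun a j => (\sum_(y <- ys) X y (a, j)) ^+ 2)) /= -/(E _).
rewrite -[X in X <= _]/(\sum_a E a) => Ele.
have E0 a : 0 <= E a by apply: sumr_ge0 => j _; apply: sqr_ge0.
(* Markov: at least half of the shifts have error at most twice the mean bound. *)
pose P := [set a | E a <= 2 * k%:R * V * n ^+ 3].
have Pbig : n <= 2 * #|P|%:R.
  have : \sum_(a in ~: P) (2 * k%:R * V * n ^+ 3) <= k%:R * (V * n ^+ 4).
    apply: le_trans Ele; rewrite [leRHS](bigID (fun a => a \in P)) /= -[leLHS]add0r.
    apply: lerD; first by apply: sumr_ge0.
    under [leRHS]eq_bigl do rewrite -in_setC.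
    by apply: ler_sum => a; rewrite !inE -ltNge => /ltW.
  rewrite sumr_const -mulr_natl => H.
  have : #|P|%:R + #|~: P|%:R = n by rewrite -natrD cardsC.
  have : #|~: P|%:R * 2 <= n.
    rewrite -(@ler_pM2r _ (k%:R * V * n ^+ 3)); last by rewrite !mulr_gt0 ?exprn_gt0.
    by apply: le_trans (le_trans _ H) _; rewrite le_eqVlt; apply/orP; left; apply/eqP; ring.
  lra.
pose bits a : k.-tuple 'I_r := [tuple of map (fun y => c (y - a)) ys].
have [|b] := @pigeonhole_card R _ _ P bits.
  by rewrite card_tuple card_ord expn_gt0 r0.
rewrite card_tuple card_ord natrX; set A' := [set a in P | _] => A'big.
have [a0 a0A] : exists a, a \in A'.
  apply/set0Pn; apply: contraTneq A'big => ->.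
  by rewrite cards0 mulr0 -ltNge; lra.
exists [set a - a0 | a in A']; split.
  rewrite card_imset; last exact: addIr.
  by rewrite -mulrA; lra.
move=> t i /imsetP[a aA ->].
rewrite -(ler_pM2l kR) mulrA -expr2.
have [aP a0P]: a \in P /\ a0 \in P by move: aA a0A; rewrite !inE => /andP[-> _] /andP[-> _].
(* Equal colour patterns make the sampled terms cancel, so only the two sampling errors remain. *)
have Xdiff x : k%:R * (h i (x + a) - h i (x + a0)) =
    (\sum_(y <- ys) X y (a0, (i, x))) - (\sum_(y <- ys) X y (a, (i, x))).
  have : bits a = bits a0.
    by move: aA a0A; rewrite !inE => /andP[_ /eqP ->] /andP[_ /eqP ->].
  move=> /(congr1 val) /= /eq_in_map cE.
  rewrite -[RHS]sumrB /X /=.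
  transitivity (\sum_(y <- ys) (h i (x + a) - h i (x + a0))).
    move: (h i _ - _) => z.
    by rewrite big_const_seq count_predT size_tuple iter_addr_0 mulr_natl.
  by apply: eq_big_seq => y yin; rewrite /ind (cE y yin); ring.
have EP (a1 : G) : a1 \in P ->
   \sum_x (\sum_(y <- ys) X y (a1, (i, x))) ^+ 2 <= 2 * k%:R * V * n ^+ 3.
  rewrite inE; apply: le_trans; rewrite /E.
  rewrite -(pair_bigA _ (fun i x => (\sum_(y <- ys) X y (a1, (i, x))) ^+ 2)) /=.
  rewrite (bigD1 i) //= lerDl; apply: sumr_ge0 => ? _.
  by apply: sumr_ge0 => ? _; apply: sqr_ge0.
rewrite -(sum_translate (fun x => (h i (x + (a - a0)) - h i x) ^+ 2) a0) mulr_sumr.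
under eq_bigr => x _.
  have -> : x + a0 + (a - a0) = x + a by rewrite -addrA subrKC.
  rewrite -exprMn Xdiff.
  over.
apply: (@le_trans _ _ (\sum_x (2 * (\sum_(y <- ys) X y (a0, (i, x))) ^+ 2 +
                              2 * (\sum_(y <- ys) X y (a, (i, x))) ^+ 2))).
  apply: ler_sum => x _.
  set u := \sum_(y <- ys) X y (a0, _); set v := \sum_(y <- ys) X y (a, _).
  by have := sqr_ge0 (u + v); nra.
rewrite big_split /= -!mulr_sumr.
by have := EP _ aP; have := EP _ a0P; lra.
Qed.

End AlmostPeriods.

(** * Smoothing over translates by almost-periods *)

Section Smoothing.
Variables (R : realFieldType) (G : finZmodType).
Let n : R := #|G|%:R.
Implicit Types (f g : G -> R) (T : {set G}).

Definition schur f g : R := \sum_x \sum_y f x * f y * g (x + y).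

Lemma schurE f g : schur f g = \sum_x f x * corr f g x.
Proof.
apply: eq_bigr => x _; rewrite /corr mulr_sumr.
by apply: eq_bigr => y _; rewrite mulrA.
Qed.

(** Substituting in [x] and [y] moves all three shifts into the argument of [g], where they act as
    one shift of the correlation. *)
Lemma schur_shift f g (s t u : G) :
  \sum_x \sum_y f (x + s) * f (y + t) * g (x + y + u) =
  \sum_x f x * corr f g (x + (u - s - t)).
Proof.
rewrite -[RHS](sum_translate _ s); apply: eq_bigr => x _.
rewrite /corr mulr_sumr -[RHS](sum_translate _ t); apply: eq_bigr => y _.
rewrite mulrA; congr (_ * _ * g _).
rewrite [x + s + _]addrA [x + s + (u - s)]addrACA subrr addr0.
by rewrite [RHS]addrACA addNr addr0 addrAC.
Qed.

(** Not divided by [#|T|], hence the factors [#|T|%:R ^+ 3] in the comparisons of [schur] below. *)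
Definition smooth T f (x : G) : R := \sum_(t in T) f (x + t).

Lemma smoothE T f u : smooth T f u = \sum_x (x - u \in T)%:R * f x.
Proof.
rewrite /smooth [RHS](reindex_inj (addrI u)) big_mkcond /=.
by apply: eq_bigr => t _; rewrite [u + t]addrC addrK; case: (t \in T); rewrite (mul1r, mul0r).
Qed.

Lemma schur_smooth T f g :
  schur (smooth T f) (smooth T g) =
  \sum_(s in T) \sum_(t in T) \sum_(u in T)
     \sum_x f x * corr f g (x + (u - s - t)).
Proof.
rewrite /schur.
under [RHS]eq_bigr => s _ do under eq_bigr => t _ do
  under eq_bigr => u _ do rewrite -schur_shift.
transitivity (\sum_x \sum_y \sum_(s in T) \sum_(t in T) \sum_(u in T)
   f (x + s) * f (y + t) * g (x + y + u)).
  apply: eq_bigr => x _; apply: eq_bigr => y _.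
  rewrite /smooth !mulr_suml; apply: eq_bigr => s _.
  rewrite -mulrA mulr_suml mulr_sumr; apply: eq_bigr => t _.
  by rewrite mulrA mulr_sumr.
under [LHS]eq_bigr => x _ do rewrite exchange_big /=.
rewrite [LHS]exchange_big /=; apply: eq_bigr => s _.
under [LHS]eq_bigr => x _ do rewrite exchange_big /=.
rewrite [LHS]exchange_big /=; apply: eq_bigr => t _.
under [LHS]eq_bigr => x _ do rewrite exchange_big /=.
by rewrite [LHS]exchange_big.
Qed.

(** Expanding gives one displaced copy of the form for each [s], [t], [u] in [T]. Its displacement
    [u - s - t] is made of three almost-periods, and pairing with the bounded [f] turns the L^2
    error into one of order [n ^+ 2 / m]. *)
Lemma schur_smooth_le T f g (m : nat) (K : R) :
  (0 < m)%N -> (forall x, 0 <= f x <= 1) ->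
  (forall t, t \in T ->
     m%:R ^+ 2 * (\sum_x (corr f g (x + t) - corr f g x) ^+ 2) <= K * n ^+ 3) ->
  schur (smooth T f) (smooth T g) <=
  #|T|%:R ^+ 3 * (schur f g + (1 + 9 * K) / m%:R * n ^+ 2).
Proof.
move=> m0 f01 TK; set h := corr f g in TK *.
have mR : 0 < m%:R :> R by rewrite ltr0n.
have n0 : 0 < n by exact: cardR_gt0.
have main s t u : s \in T -> t \in T -> u \in T ->
    \sum_x f x * h (x + (u - s - t)) <= schur f g + (1 + 9 * K) / m%:R * n ^+ 2.
  move=> sT tT uT; rewrite schurE -/h -lerBlDl -sumrB.
  under eq_bigr do rewrite -mulrBr.
  pose D x := h (x + (u - s - t)) - h x.
  (* The shift telescopes into three almost-period steps. Squaring a sum of three terms costs a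
     factor 3, and there are three terms, hence 9. *)
  have D2 : m%:R ^+ 2 * (\sum_x D x ^+ 2) <= 9 * K * n ^+ 3.
    pose d v x := h (x + v) - h x.
    have -> : \sum_x D x ^+ 2 = \sum_x (d u x - d s (x + (u - s)) - d t (x + (u - s - t))) ^+ 2.
      apply: eq_bigr => x _; congr (_ ^+ 2); rewrite /D /d.
      by rewrite !addrA !subrK; ring.
    have leD : \sum_x (d u x - d s (x + (u - s)) - d t (x + (u - s - t))) ^+ 2
      <= \sum_x (3 * d u x ^+ 2 + 3 * d s (x + (u - s)) ^+ 2 + 3 * d t (x + (u - s - t)) ^+ 2).
      apply: ler_sum => x _.
      move: (d u x) (d s _) (d t _) => a b e.
      have := sqr_ge0 (a + b); have := sqr_ge0 (a + e); have := sqr_ge0 (b - e); nra.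
    move: leD; rewrite !big_split /= -!mulr_sumr.
    rewrite (sum_translate (fun x => d s x ^+ 2)) (sum_translate (fun x => d t x ^+ 2)).
    rewrite -(ler_pM2l (exprn_gt0 2 mR)).
    by have := TK _ sT; have := TK _ tT; have := TK _ uT; rewrite -/(d _); rewrite /d; lra.
  (* AM-GM with the scale [n / m] of the almost-period bound *)
  have le1 x : f x * D x <= n / m%:R + m%:R / n * D x ^+ 2.
    have /andP[f0 f1] := f01 x.
    have a0 : 0 < m%:R / n by apply: divr_gt0.
    have -> : n / m%:R = (m%:R / n)^-1 by rewrite invf_div.
    move: (m%:R / n) a0 (D x) (f x) f0 f1 => a a0 e b b0 b1.
    rewrite -(ler_pM2l a0) mulrDr divff ?gt_eqF //.
    by have := sqr_ge0 (a * e - b / 2); nra.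
  apply: le_trans (ler_sum _ (fun x _ => le1 x)) _.
  rewrite big_split /= sumr_const -[_ *+ #|G|]mulr_natl -/n.
  have -> : (1 + 9 * K) / m%:R * n ^+ 2 =
     n * (n / m%:R) + m%:R / n * (9 * K * n ^+ 3 / m%:R ^+ 2).
    by field; rewrite !gt_eqF.
  rewrite lerD2l -mulr_sumr ler_wpM2l //; first by rewrite divr_ge0 ?ltW.
  by rewrite ler_pdivlMr ?exprn_gt0 // mulrC.
rewrite schur_smooth.
set B := _ + _ in main *.
have -> : #|T|%:R ^+ 3 * B = \sum_(s in T) \sum_(t in T) \sum_(u in T) B.
  by rewrite !sumr_const; ring.
by apply: ler_sum => s sT; apply: ler_sum => t tT; apply: ler_sum => u uT; apply: main.
Qed.

Lemma sum_schur_smooth_le r (c : G -> 'I_r) (g : 'I_r -> G -> R) T (m : nat) (K : R) :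
  (0 < m)%N ->
  (forall t i, t \in T -> m%:R ^+ 2 *
     (\sum_x (corr (ind R c i) (g i) (x + t) - corr (ind R c i) (g i) x) ^+ 2) <= K * n ^+ 3) ->
  \sum_i schur (smooth T (ind R c i)) (smooth T (g i)) <=
  #|T|%:R ^+ 3 * (\sum_i schur (ind R c i) (g i) + r%:R * ((1 + 9 * K) / m%:R) * n ^+ 2).
Proof.
move=> m0 TK.
have -> : r%:R * ((1 + 9 * K) / m%:R) * n ^+ 2 = \sum_(i < r) (1 + 9 * K) / m%:R * n ^+ 2.
  by rewrite sumr_const card_ord; ring.
rewrite -big_split mulr_sumr; apply: ler_sum => i _.
apply: schur_smooth_le => // [x|t tT]; last exact: TK.
by rewrite ind_ge0 lern1 leq_b1.
Qed.

End Smoothing.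

(** * Equidistribution of the graph of a planar map *)

Section Planar.
Variables (R : realFieldType) (G : finZmodType) (q : G -> G).
Hypothesis planar : forall h, h != 0 -> injective (fun z => q (z + h) - q z).
Let n : R := #|G|%:R.
Implicit Types (f : G -> R) (T : {set G}).

Definition pushforward f (w : G) : R := \sum_z (q z == w)%:R * f z.

Lemma sum_differences (F : G -> G -> R) :
  \sum_z \sum_z' F z z' = \sum_h \sum_z F z (z + h).
Proof.
rewrite [RHS]exchange_big; apply: eq_bigr => z _ /=.
by rewrite [LHS](reindex_inj (addrI z)).
Qed.

Lemma planar_sum (F : G -> R) h : h != 0 -> \sum_z F (q (z + h) - q z) = \sum_w F w.
Proof. by move=> /planar inj; rewrite [RHS](reindex_inj inj). Qed.

(** The sum counts collisions [q z = q z'] with weights at most 1. The diagonal gives at most [n],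
    and planarity allows one [z] for each difference [h != 0], so at most [n] more. *)
Lemma sum_pushforward_sqr f : (forall z, 0 <= f z <= 1) ->
  \sum_w pushforward f w ^+ 2 <= 2 * n.
Proof.
move=> f01.
have -> : \sum_w pushforward f w ^+ 2 =
    \sum_z \sum_z' (q z == q z')%:R * (f z * f z').
  under eq_bigr => w _ do rewrite expr2 {1}/pushforward mulr_suml.
  rewrite exchange_big; apply: eq_bigr => z _ /=.
  rewrite (bigD1 (q z)) //= eqxx mul1r [X in _ + X]big1 ?addr0; last first.
    by move=> w /negbTE; rewrite eq_sym => ->; rewrite !mul0r.
  rewrite /pushforward mulr_sumr; apply: eq_bigr => z' _.
  by rewrite eq_sym mulrCA.
have term z z' : (q z == q z')%:R * (f z * f z') <= (q (z') - q z == 0)%:R.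
  have /andP[a0 a1] := f01 z; have /andP[b0 b1] := f01 z'.
  by rewrite subr_eq0 eq_sym ler_piMr // mulr_ile1.
rewrite sum_differences.
apply: le_trans (ler_sum _ (fun h _ => ler_sum _ (fun z _ => term _ _))) _.
rewrite (bigD1 0) //= mulrDl mul1r.
under eq_bigr do rewrite addr0 subrr eqxx.
rewrite sumr_const lerD2l.
under eq_bigr => h h0.
  rewrite (planar_sum (fun w => (w == 0)%:R) h0) (bigD1 0) //= eqxx big1; last first.
    by move=> w /negbTE ->.
  over.
rewrite addr0 sumr_const ler_nat.
exact: max_card.
Qed.

Lemma sum_setR T : \sum_x (x \in T)%:R = #|T|%:R :> R.
Proof. by rewrite -natr_sum -big_mkcond sum1_card. Qed.

(** Weighted count of the points of the graph of [q] in the box with sides [u + T] and [v + T]. Its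
    marginals are multiples of the smoothings of [f] and of its pushforward. *)
Definition joint T f (u v : G) : R :=
  \sum_z (z - u \in T)%:R * (q z - v \in T)%:R * f z.

Lemma sum_joint_r T f u : \sum_v joint T f u v = #|T|%:R * smooth T f u.
Proof.
rewrite smoothE /joint exchange_big mulr_sumr; apply: eq_bigr => z _ /=.
rewrite -mulr_suml -mulr_sumr (sum_translateN (fun x => (x \in T)%:R)) sum_setR.
by rewrite [_ * #|T|%:R]mulrC mulrA.
Qed.

Lemma sum_joint_l T f v :
  \sum_u joint T f u v = #|T|%:R * smooth T (pushforward f) v.
Proof.
have -> : smooth T (pushforward f) v = \sum_z (q z - v \in T)%:R * f z.
  rewrite smoothE /pushforward.
  under eq_bigr do rewrite mulr_sumr.
  rewrite exchange_big; apply: eq_bigr => z _ /=.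
  rewrite (bigD1 (q z)) //= eqxx mul1r big1 ?addr0 // => w /negbTE.
  by rewrite eq_sym => ->; rewrite mul0r mulr0.
rewrite /joint exchange_big mulr_sumr; apply: eq_bigr => z _ /=.
rewrite -!mulr_suml (sum_translateN (fun x => (x \in T)%:R)) sum_setR.
by rewrite mulrA.
Qed.

(** A variance bound. Since [q (z + h) - q z] runs once over the group for [h != 0], the pairs of
    distinct graph points contribute at most [m ^+ 4], which the squared mean cancels. Only the
    diagonal [h = 0] is left. *)
Lemma joint_second_moment T :
  \sum_u \sum_v (joint T (fun=> 1) u v - #|T|%:R ^+ 2 / n) ^+ 2 <= n * #|T|%:R ^+ 2.
Proof.
have n0 : 0 < n by exact: cardR_gt0.
set m : R := #|T|%:R.
pose tau (x : G) : R := (x \in T)%:R.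
pose rr h := \sum_u tau u * tau (u + h).
have rrE z z' : \sum_u tau (z - u) * tau (z' - u) = rr (z' - z).
  rewrite /rr -[RHS](sum_translateN _ z); apply: eq_bigr => u _; congr (_ * tau _).
  by rewrite [RHS]addrC addrA subrK.
have rr0 : rr 0 = m.
  rewrite /rr /m -sum_setR; apply: eq_bigr => u _.
  by rewrite addr0 /tau; case: (_ \in _); rewrite ?mulr1 ?mulr0.
have sum_rr : \sum_h rr h = m ^+ 2.
  rewrite /rr exchange_big /=.
  under eq_bigr => u _.
    rewrite -mulr_sumr.
    under eq_bigr do rewrite addrC.
    rewrite (sum_translate tau) /tau sum_setR.
    over.
  by rewrite -mulr_suml sum_setR.
have rr_ge0 h : 0 <= rr h by apply: sumr_ge0 => u _; apply: mulr_ge0; apply: ler0n.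
have WE u v : joint T (fun=> 1) u v = \sum_z tau (z - u) * tau (q z - v).
  by apply: eq_bigr => z _; rewrite mulr1.
have W2 : \sum_u \sum_v joint T (fun=> 1) u v ^+ 2 <= n * m ^+ 2 + m ^+ 4.
  have -> : \sum_u \sum_v joint T (fun=> 1) u v ^+ 2 =
      \sum_z \sum_z' rr (z' - z) * rr (q z' - q z).
    transitivity (\sum_u \sum_v \sum_z \sum_z'
        (tau (z - u) * tau (z' - u)) * (tau (q z - v) * tau (q z' - v))).
      apply: eq_bigr => u _; apply: eq_bigr => v _.
      rewrite WE expr2 big_distrlr; apply: eq_bigr => z _; apply: eq_bigr => z' _ /=.
      exact: mulrACA.
    under [LHS]eq_bigr => u _ do rewrite exchange_big /=.
    rewrite [LHS]exchange_big /=; apply: eq_bigr => z _.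
    under [LHS]eq_bigr => u _ do rewrite exchange_big /=.
    rewrite [LHS]exchange_big /=; apply: eq_bigr => z' _.
    under eq_bigr => u _ do rewrite -mulr_sumr rrE.
    by rewrite -mulr_suml rrE.
  rewrite sum_differences.
  under eq_bigr => h _.
    under eq_bigr => z _ do rewrite [z + h]addrC addrK [h + z]addrC.
    rewrite -mulr_sumr.
    over.
  rewrite (bigD1 0) //=; apply: lerD.
    under eq_bigr do rewrite addr0 subrr rr0.
    by rewrite rr0 sumr_const le_eqVlt; apply/orP; left; apply/eqP; rewrite /n; ring.
  under eq_bigr => h h0 do rewrite (planar_sum rr h0) sum_rr.
  rewrite -mulr_suml.
  have -> : m ^+ 4 = (\sum_h rr h) * m ^+ 2 by rewrite sum_rr; ring.
  rewrite ler_wpM2r ?sqr_ge0 // [leRHS](bigD1 0) //=.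
  by rewrite lerDr rr_ge0.
have W1 : \sum_u \sum_v joint T (fun=> 1) u v = n * m ^+ 2.
  under eq_bigr do rewrite sum_joint_r.
  rewrite -mulr_sumr.
  have -> : \sum_u smooth T (fun=> 1 : R) u = n * m.
    rewrite /smooth; under eq_bigr do rewrite sumr_const.
    by rewrite sumr_const -[_ *+ #|G|]mulr_natl.
  by rewrite /m; ring.
set a := m ^+ 2 / n.
have -> : \sum_u \sum_v (joint T (fun=> 1) u v - a) ^+ 2 =
   \sum_u \sum_v joint T (fun=> 1) u v ^+ 2 - 2 * a * (n * m ^+ 2) + n ^+ 2 * a ^+ 2.
  rewrite -W1 mulr_sumr -sumrB.
  have -> : n ^+ 2 * a ^+ 2 = \sum_(u : G) \sum_(v : G) a ^+ 2.
    by rewrite !sumr_const /n; ring.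
  rewrite -big_split; apply: eq_bigr => u _ /=.
  rewrite mulr_sumr -sumrB -big_split; apply: eq_bigr => v _ /=; ring.
have an : a * n = m ^+ 2 by rewrite /a divfK ?gt_eqF.
have -> : 2 * a * (n * m ^+ 2) = 2 * m ^+ 4 by rewrite mulrA -(mulrA 2) an; ring.
have -> : n ^+ 2 * a ^+ 2 = m ^+ 4 by rewrite -exprMn mulrC an; ring.
lra.
Qed.

End Planar.

(** * Colours that are dense in two windows at once *)

Section PopularColours.
Variables (R : realFieldType) (G : finZmodType) (q : G -> G).
Hypothesis planar : forall h, h != 0 -> injective (fun z => q (z + h) - q z).
Variables (r : nat) (c : G -> 'I_r) (T : {set G}) (d : R).
Hypotheses (T_gt0 : (0 < #|T|)%N) (d_gt0 : 0 < d).
Let n : R := #|G|%:R.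
Let m : R := #|T|%:R.
Let f i := ind R c i.
Let g i := pushforward q (f i).

Definition popular (h : 'I_r -> G -> R) (u : G) : {set 'I_r} :=
  [set i | d * m <= smooth T (h i) u].

Definition bad_pairs : {set G * G} :=
  [set w | popular f w.1 :&: popular g w.2 == set0].

Lemma joint_ge0 i u v : 0 <= joint q T (f i) u v.
Proof. by apply: sumr_ge0 => z _; rewrite !mulr_ge0 ?ler0n ?ind_ge0. Qed.

Lemma sum_joint u v : \sum_i joint q T (f i) u v = joint q T (fun=> 1) u v.
Proof.
rewrite exchange_big; apply: eq_bigr => z _ /=.
by rewrite -mulr_sumr sum_ind.
Qed.

(** At a bad pair every colour is unpopular at [u] or at [v], so its share of the joint count
    appears in one of the two sums. *)
Lemma bad_joint u v : (u, v) \in bad_pairs ->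
  joint q T (fun=> 1) u v <= \sum_(i | i \notin popular f u) joint q T (f i) u v
                           + \sum_(i | i \notin popular g v) joint q T (f i) u v.
Proof.
rewrite inE /= => /eqP dis; rewrite -sum_joint (bigID (mem (popular f u))) /= addrC lerD2l.
rewrite [leLHS]big_mkcond [leRHS]big_mkcond /=; apply: ler_sum => i _.
case: ifP => iu; case: ifP => //; rewrite ?joint_ge0 //.
move=> /negbFE iv.
by have := in_set0 i; rewrite -dis inE iu iv.
Qed.

Lemma unpopular_sum (h : 'I_r -> G -> R) :
  \sum_u \sum_(i | i \notin popular h u) m * smooth T (h i) u <= r%:R * d * n * m ^+ 2.
Proof.
have m0 : 0 < m by rewrite ltr0n.
have -> : r%:R * d * n * m ^+ 2 = \sum_(u : G) \sum_(i < r) m * (d * m).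
  by rewrite !sumr_const card_ord /n; ring.
apply: ler_sum => u _; rewrite big_mkcond; apply: ler_sum => i _.
case: ifP => [|_]; last by rewrite !mulr_ge0 ?ltW.
by rewrite inE -ltNge ler_pM2l // => /ltW.
Qed.

(** On bad pairs the joint count comes from unpopular colours and has a small total, while the
    variance bound keeps it near [m ^+ 2 / n] for most pairs. *)
Lemma card_bad_pairs :
  3 / 4 * (m ^+ 2 / n) * #|bad_pairs|%:R <= 2 * r%:R * d * n * m ^+ 2 + n ^+ 2.
Proof.
have m0 : 0 < m by rewrite ltr0n.
have n0 : 0 < n by exact: cardR_gt0.
set a := m ^+ 2 / n.
have a0 : 0 < a by rewrite divr_gt0 ?exprn_gt0.
pose W u v : R := joint q T (fun=> 1) u v.
(* Either the count or its deviation from [a] is comparable to [a]. Completing the square at [a / 2]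
   gives the constant 3/4. *)
have lowW u v : 3 / 4 * a <= W u v + (W u v - a) ^+ 2 / a.
  rewrite -(ler_pM2l a0) mulrDr [X in _ <= _ + X]mulrC divfK ?gt_eqF //.
  by have := sqr_ge0 (W u v - a / 2); nra.
have -> : 3 / 4 * a * #|bad_pairs|%:R = \sum_(w in bad_pairs) 3 / 4 * a.
  by rewrite sumr_const; ring.
apply: le_trans (ler_sum _ (fun w _ => lowW w.1 w.2)) _.
rewrite big_split /=; apply: lerD.
  apply: (@le_trans _ _ (\sum_u \sum_v
     (\sum_(i | i \notin popular f u) joint q T (f i) u v
      + \sum_(i | i \notin popular g v) joint q T (f i) u v))).
    rewrite pair_bigA big_mkcond; apply: ler_sum => -[u v] _.
    case: ifP => [/bad_joint //|_].
    by rewrite addr_ge0 // sumr_ge0 // => i _; apply: joint_ge0.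
  have -> : 2 * r%:R * d * n * m ^+ 2 =
     r%:R * d * n * m ^+ 2 + r%:R * d * n * m ^+ 2 by ring.
  under eq_bigr do rewrite big_split /=.
  rewrite big_split; apply: lerD.
    apply: le_trans (unpopular_sum f).
    apply: ler_sum => u _; rewrite exchange_big /=; apply: ler_sum => i _.
    by rewrite sum_joint_r.
  apply: le_trans (unpopular_sum g).
  rewrite exchange_big /=.
  apply: ler_sum => v _; rewrite exchange_big /=; apply: ler_sum => i _.
  by rewrite sum_joint_l.
rewrite -mulr_suml ler_pdivrMr //.
have -> : n ^+ 2 * a = n * m ^+ 2 by rewrite /a; field; rewrite gt_eqF.
apply: (le_trans _ (joint_second_moment R planar T)).
rewrite pair_bigA big_mkcond; apply: ler_sum => w _.
by case: ifP => // _; apply: sqr_ge0.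
Qed.

(* Pigeonhole on [popular f u] gives a large set [S] with a common value [I0].
   Each [v] whose popular colours miss [I0] is bad with every element of [S],
   hence such [v] are rare, and a random [u1 + u2] with [u1], [u2] in [S] avoids
   them. *)
Lemma schur_smooth_lower :
  (d * m) ^+ 3 * ((n / 2 ^+ r) ^+ 2 - #|bad_pairs|%:R) <=
  \sum_i schur (smooth T (f i)) (smooth T (g i)).
Proof.
have m0 : 0 < m by rewrite ltr0n.
have n0 : 0 < n by exact: cardR_gt0.
have dm0 : 0 < d * m by apply: mulr_gt0.
have card_colours : #|{set 'I_r}| = (2 ^ r)%N.
  by rewrite -cardsT -powersetT card_powerset cardsT card_ord.
have [|I0] := @pigeonhole_card R _ _ [set: G] (popular f).
  by rewrite card_colours expn_gt0.
rewrite cardsT card_colours natrX -/n; set S := [set u in _ | _] => nS.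
pose V := [set v | I0 :&: popular g v == set0].
have SV : (#|S| * #|V| <= #|bad_pairs|)%N.
  rewrite -cardsX; apply: subset_leq_card; apply/subsetP => -[u v].
  by rewrite !inE /= => /andP[/eqP -> ].
have smooth_ge0 h u : (forall x, 0 <= h x) -> 0 <= smooth T h u :> R.
  by move=> h0; apply: sumr_ge0.
have f0 i x : 0 <= f i x by apply: ind_ge0.
have g0 i x : 0 <= g i x by apply: sumr_ge0 => z _; rewrite mulr_ge0 ?ler0n.
pose P u v i := smooth T (f i) u * smooth T (f i) v * smooth T (g i) (u + v).
have P0 u v i : 0 <= P u v i by rewrite !mulr_ge0 ?smooth_ge0.
(* If [u + v] is not in [V], some colour of [I0] is popular for [g] there. It is also popular for
   [f] at [u] and [v], whose popular sets are both [I0]. *)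
have lowP u v : u \in S -> v \in S ->
    (d * m) ^+ 3 * (1 - (u + v \in V)%:R) <= \sum_i P u v i.
  rewrite !inE => /eqP uS /eqP vS; case: eqP => [_|/eqP].
    by rewrite subrr mulr0; apply: sumr_ge0.
  case/set0Pn => i; rewrite inE subr0 mulr1 => /andP[iI].
  move: (iI); rewrite -{1}uS => iu; move: iI; rewrite -vS => iv iuv.
  move: iu iv iuv; rewrite !inE => iu iv iuv.
  rewrite (bigD1 i) //= -[leLHS]addr0; apply: lerD; last by apply: sumr_ge0.
  by rewrite exprS expr2 mulrA /P !ler_pM ?mulr_ge0 // ltW.
have -> : \sum_i schur (smooth T (f i)) (smooth T (g i)) = \sum_u \sum_v \sum_i P u v i.
  rewrite /schur exchange_big; apply: eq_bigr => u _.
  by rewrite exchange_big.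
apply: (@le_trans _ _ (\sum_(u in S) \sum_(v in S) (d * m) ^+ 3 * (1 - (u + v \in V)%:R))); last first.
  rewrite [leLHS]big_mkcond; apply: ler_sum => u _.
  case: ifP => uS; last by apply: sumr_ge0 => v _; apply: sumr_ge0.
  rewrite [leLHS]big_mkcond; apply: ler_sum => v _.
  case: ifP => vS; last by apply: sumr_ge0.
  exact: lowP.
under eq_bigr => u _ do rewrite -mulr_sumr.
rewrite -mulr_sumr ler_pM2l ?exprn_gt0 //.
have rowV u : \sum_(v in S) (u + v \in V)%:R <= #|V|%:R :> R.
  rewrite -(sum_setR R V) -(sum_translate _ u).
  rewrite big_mkcond; apply: ler_sum => v _; rewrite [v + u]addrC.
  by case: ifP => // _; apply: ler0n.
apply: (@le_trans _ _ (\sum_(u in S) (#|S|%:R - #|V|%:R))); last first.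
  by apply: ler_sum => u _; rewrite sumrB sumr_const lerD2l lerN2.
rewrite sumr_const -[_ *+ #|S|]mulr_natl mulrBr -natrM -natrM.
apply: lerB; last by rewrite ler_nat.
rewrite natrM -expr2; apply: lerXn2r.
- by rewrite nnegrE divr_ge0 ?exprn_ge0 // ltW.
- by rewrite nnegrE ler0n.
- by rewrite ler_pdivrMr ?exprn_gt0 // mulrC.
Qed.

End PopularColours.

(** * Choice of parameters and the bound for planar maps *)

Lemma planar_schur_arith (R : realFieldType) (n m b L S rd d Q B e : R) :
  0 < n -> 0 < m -> 0 < d -> 0 < Q -> 0 < rd -> rd = (8 * Q ^+ 2)^-1 ->
  B ^+ 2 / rd <= n -> n <= B * m ->
  3 / 4 * (m ^+ 2 / n) * b <= 2 * rd * n * m ^+ 2 + n ^+ 2 ->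
  (d * m) ^+ 3 * ((n / Q) ^+ 2 - b) <= S ->
  S <= m ^+ 3 * (L + e * n ^+ 2) ->
  e = d ^+ 3 / (4 * Q ^+ 2) ->
  d ^+ 3 / (4 * Q ^+ 2) * n ^+ 2 <= L.
Proof.
move=> n0 m0 d0 Q0 rd0 rdE Bn nBm bad low up eE.
(* The lower bound on [n] makes the variance term [n ^+ 2] at most [rd * n * m ^+ 2], so both terms
   of [bad] have the same shape. *)
have bS : b <= 4 * rd * n ^+ 2.
  have m2 : 0 < m ^+ 2 by rewrite exprn_gt0.
  have : n ^+ 2 <= rd * n * m ^+ 2.
    have B0 : 0 < B by rewrite -(pmulr_lgt0 _ m0); apply: lt_le_trans nBm.
    have : n ^+ 2 <= B ^+ 2 * m ^+ 2 by rewrite -exprMn lerXn2r ?nnegrE ?mulr_ge0 // ltW.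
    move: Bn; rewrite ler_pdivrMr // => Bn; move=> H; apply: (le_trans H).
    by rewrite ler_pM2r // mulrC.
  move=> H; have {H} bad : 3 / 4 * (m ^+ 2 / n) * b <= 3 * rd * n * m ^+ 2 by lra.
  rewrite -(@ler_pM2l _ (3 / 4 * (m ^+ 2 / n))) ?mulr_gt0 ?invr_gt0 //.
  apply: le_trans bad _; rewrite le_eqVlt; apply/orP; left; apply/eqP.
  by field; rewrite gt_eqF.
have yE : d ^+ 3 / (4 * Q ^+ 2) * n ^+ 2 = d ^+ 3 * (n / Q) ^+ 2 / 4.
  by field; rewrite gt_eqF.
have {}bS : b <= (n / Q) ^+ 2 / 2.
  apply: le_trans bS _; rewrite le_eqVlt; apply/orP; left; apply/eqP.
  by rewrite rdE; field; rewrite gt_eqF.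
rewrite eE yE in up *; move: (n / Q) bS low up => y bS low up.
(* Bad pairs use up at most half of [y ^+ 2]. The smoothing error takes half of what remains, and a
   quarter is left. *)
have : m ^+ 3 * (d ^+ 3 * y ^+ 2 / 2) <= m ^+ 3 * (L + d ^+ 3 * y ^+ 2 / 4).
  apply: le_trans up; apply: le_trans low.
  rewrite exprMn [d ^+ 3 * m ^+ 3]mulrC -[leRHS]mulrA ler_pM2l ?exprn_gt0 //.
  by rewrite -[leLHS]mulrA ler_pM2l ?exprn_gt0 //; lra.
by rewrite ler_pM2l ?exprn_gt0 //; lra.
Qed.

(** First the threshold [d] makes bad pairs rare, then [M] makes the smoothing error small against
    the gain, then [N] makes the variance term negligible. *)
Lemma planar_schur (R : realFieldType) (r : nat) : (0 < r)%N ->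
  exists e N : R, 0 < e /\
    forall (G : finZmodType) (q : G -> G),
    (forall h, h != 0 -> injective (fun z => q (z + h) - q z)) ->
    N <= #|G|%:R -> forall c : G -> 'I_r,
    e * #|G|%:R ^+ 2 <= \sum_i schur (ind R c i) (pushforward q (ind R c i)).
Proof.
move=> r0.
(* [D] gives [r * d = 1 / (8 * 4 ^ r)]. In [M], 580 is 4 times the 145 = 1 + 9 * 16 of the smoothing
   error, which becomes exactly [d ^+ 3 / (4 * Q ^+ 2)]. *)
pose D := (8 * r * 4 ^ r)%N; pose M := (580 * 4 ^ r * r * D ^ 3)%N.
have D0 : (0 < D)%N by rewrite !muln_gt0 r0 expn_gt0.
have M0 : (0 < M)%N by rewrite !(muln_gt0, expn_gt0) r0.
pose d : R := D%:R^-1; pose Q : R := 2 ^+ r.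
have d0 : 0 < d by rewrite invr_gt0 ltr0n.
have Q0 : 0 < Q by rewrite exprn_gt0.
have rR : 0 < r%:R :> R by rewrite ltr0n.
have QE : (4 ^ r)%:R = Q ^+ 2 by rewrite natrX /Q -exprM mulnC exprM; congr (_ ^+ r); ring.
pose B : R := 2 * r%:R ^+ (M ^ 2).
have rd : r%:R * d = (8 * Q ^+ 2)^-1.
  by rewrite /d /D !natrM QE; field; rewrite ?gt_eqF.
exists (d ^+ 3 / (4 * Q ^+ 2)), (B ^+ 2 / (r%:R * d)); split.
  by rewrite divr_gt0 ?mulr_gt0 ?exprn_gt0.
move=> G q planar nN c; set n := #|G|%:R in nN *.
have n0 : 0 < n by exact: cardR_gt0.
(* The variance parameter 2 is the bound for pushforwards, so the factor [8 * V] becomes the 16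
   below. *)
have [|||T [nT TP]] := @almost_periods R G r c (fun i => pushforward q (ind R c i)) 2 (M ^ 2) r0.
- by rewrite expn_gt0 M0.
- by [].
- by move=> i; apply: sum_pushforward_sqr => // x; rewrite ind_ge0 lern1 leq_b1.
rewrite -/n -/B in nT TP.
have m0 : 0 < #|T|%:R :> R.
  rewrite ltNge; apply/negP => m0; move: nT; rewrite leNgt (le_lt_trans _ n0) //.
  by rewrite mulr_ge0_le0 // mulr_ge0 // exprn_ge0 // ltW.
have T0 : (0 < #|T|)%N by rewrite ltr0n in m0.
have up : \sum_i schur (smooth T (ind R c i)) (smooth T (pushforward q (ind R c i))) <=
    #|T|%:R ^+ 3 * (\sum_i schur (ind R c i) (pushforward q (ind R c i))
                    + r%:R * ((1 + 9 * 16) / M%:R) * n ^+ 2).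
  apply: sum_schur_smooth_le => // t i tT.
  by rewrite -natrX; apply: le_trans (TP t i tT) _; rewrite -/n; lra.
have bad := card_bad_pairs planar c T0 d0.
have low := schur_smooth_lower q c T0 d0.
rewrite -/n in bad low.
apply: (planar_schur_arith n0 m0 d0 Q0 _ rd nN _ _ low up).
- by rewrite mulr_gt0.
- exact: nT.
- by rewrite [2 * (_ * d)]mulrA.
have -> : M%:R = 580 * Q ^+ 2 * r%:R * d^-1 ^+ 3.
  by rewrite 3!natrM QE [(D ^ 3)%:R]natrX invrK.
by field; rewrite !gt_eqF.
Qed.


(** * Squaring on the prime field *)

Lemma sum_schur_mono (R : realFieldType) (p r : nat) (c : 'F_p -> 'I_r) :
  \sum_i schur (ind R c i) (pushforward (fun z => z ^+ 2) (ind R c i)) =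
  #|mono_triples c|%:R.
Proof.
have -> : #|mono_triples c|%:R =
    \sum_x \sum_y \sum_z ((x, y, z) \in mono_triples c)%:R :> R.
  rewrite pair_bigA /= pair_bigA /= -sum1_card natr_sum big_mkcond.
  by apply: eq_bigr => -[[x y] z] _ /=; case: ifP.
rewrite /schur exchange_big; apply: eq_bigr => x _ /=.
rewrite exchange_big; apply: eq_bigr => y _ /=.
rewrite /pushforward; under eq_bigr do rewrite mulr_sumr.
rewrite exchange_big; apply: eq_bigr => z _ /=.
(* Only the colour [i = c z] survives, because the pushforward carries the indicator of colour [i]
   at [z]. *)
rewrite inE (bigD1 (c z)) //= big1 ?addr0 => [|i /negbTE iz]; last first.
  by rewrite /ind [c z == i]eq_sym iz !mulr0.
rewrite /ind eqxx mulr1 -!natrM mulnb mulnb.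
rewrite [z ^+ 2 == _]eq_sym; case: (x + y == _); rewrite ?andbF //= andbT.
by case: (altP (c y =P c z)) => [->|_]; rewrite ?andbT ?andbF.
Qed.

(** The values at [x] and [y] differ by [2 * h * (x - y)], and 2 is invertible for odd [p]. *)
Lemma sqr_planar (p : nat) : prime p -> (2 < p)%N ->
  forall h : 'F_p, h != 0 -> injective (fun z => (z + h) ^+ 2 - z ^+ 2).
Proof.
move=> pp p2 h h0 x y /= E.
have two : 2%:R != 0 :> 'F_p.
  by rewrite -(dvdn_pcharf (pchar_Fp pp)) gtnNdvd.
have : 2%:R * h * (x - y) = 0.
  have -> : 2%:R * h * (x - y) = ((x + h) ^+ 2 - x ^+ 2) - ((y + h) ^+ 2 - y ^+ 2) by ring.
  by rewrite E subrr.
by move/eqP; rewrite !mulf_eq0 (negbTE two) (negbTE h0) /= subr_eq0 => /eqP.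
Qed.

Theorem theorem1p1 (R : realType) (r : nat) (r_gt0 : (0 < r)%N) :
  exists2 c_r : R, 0 < c_r &
    forall (p : nat), prime p -> forall c : 'F_p -> 'I_r,
      c_r * p%:R ^+ 2 <= #|mono_triples c|%:R.
Proof.
have [e [N [e0 eN]]] := planar_schur R r_gt0.
(* The maximum with 3 makes every prime [p >= N'] odd. *)
pose N' := Num.max N 3.
have N0 : 0 < N' by rewrite lt_max ltr0n orbT.
exists (Num.min e (N' ^- 2)) => [|p pp c].
  by rewrite lt_min e0 invr_gt0 exprn_gt0.
have [pN|pN] := leP N' p%:R.
  have p2 : (2 < p)%N.
    by rewrite -(ltr_nat R); apply: lt_le_trans pN; rewrite lt_max ltr_nat orbT.
  rewrite -(sum_schur_mono R).
  apply: le_trans (eN _ _ (sqr_planar pp p2) _ c); rewrite card_Fp //.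
    by rewrite ler_wpM2r ?exprn_ge0 // ge_min lexx.
  by apply: le_trans pN; rewrite le_max lexx.
(* For [p < N'] the required number is at most 1, and the zero triple suffices. *)
apply: (@le_trans _ _ 1).
  apply: (@le_trans _ _ (N' ^- 2 * p%:R ^+ 2)).
    by rewrite ler_wpM2r ?exprn_ge0 // ge_min lexx orbT.
  rewrite mulrC ler_pdivrMr ?exprn_gt0 // mul1r.
  by apply: lerXn2r; rewrite ?nnegrE ?ler0n // ltW.
rewrite ler1n card_gt0; apply/set0Pn; exists (0, 0, 0).
by rewrite inE addr0 expr0n !eqxx.
Qed.
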